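(* For locally compact spaces $X$ and $Y$ the following conditions are equivalent. (1) $\mathcal T(X)$ and $\mathcal T(Y)$ are order-isomorphic; (2) $\mathcal T_C(X)$ and $\mathcal T_C(Y)$ are order-isomorphic; (3) $X^*$ and $Y^*$ are homeomorphic.
   Context: Locally compact spaces and compact spaces are assumed Hausdorff. For a Tychonoff space $X$, a one-point extension of $X$ is a Tychonoff space $T$ containing $X$ as a dense subspace such that $T\setminus X$ is a singleton. Two extensions are identified if there is a homeomorphism between them fixing $X$ pointwise. For extensions $T_1,T_2$ of $X$, $T_2\leq T_1$ means there is a continuous $f:T_1\to T_2$ fixing $X$ pointwise; this is a partial order on the set $\mathcal T(X)$ of all (equivalence classes of) one-point extensions of $X$. $\mathcal T_C(X)=\{T\in\mathcal T(X): T\text{ is Čech-complete}\}$ with the induced order. $\beta X$ is the Stone-Čech compactification of $X$ and $X^*=\beta X\setminus X$. Partially ordered sets are order-isomorphic if there is a bijection between them that is order-preserving with order-preserving inverse. *)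

(* Defs.v *)
From HB Require Import structures.
From mathcomp Require Import all_boot all_order all_algebra.
From mathcomp Require Import all_classical all_reals.
From mathcomp Require Import topology normedtype borel_hierarchy.

Set Implicit Arguments.
Unset Strict Implicit.
Unset Printing Implicit Defensive.

Import Order.TTheory GRing.Theory Num.Theory.
Import numFieldNormedType.Exports.

Local Open Scope classical_set_scope.
Local Open Scope ring_scope.

Definition homeomorphism (S T : topologicalType) (f : S -> T) : Prop :=
  continuous f /\
  exists g : T -> S, [/\ cancel f g, cancel g f & continuous g].

Definition homeomorphic (S T : topologicalType) : Prop :=
  exists f : S -> T, homeomorphism f.

(* The second clause says that S carries the topology induced from T along e;
   in particular e is continuous. *)
Definition topological_embedding (S T : topologicalType) (e : S -> T) : Prop :=
  injective e /\
  forall U : set S, open U <-> exists2 V : set T, open V & U = e @^-1` V.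

Definition tychonoff_space (T : topologicalType) : Prop :=
  completely_regular_space T /\ hausdorff_space T.

(* beta X is realized as the closure of the image of X under the evaluation map
   X -> [0,1]^C(X,[0,1]). *)
Section stone_cech.
Variables (R : realType) (X : topologicalType).

Definition unit_interval : topologicalType := set_type (`[0, 1]%classic : set R).

Definition stone_cech_cube : topologicalType :=
  prod_topology (fun _ : continuousType X unit_interval => unit_interval).

Definition stone_cech_eval (x : X) : stone_cech_cube := fun f => f x.

Definition stone_cech : topologicalType :=
  set_type (closure (range stone_cech_eval)).

Definition stone_cech_emb (x : X) : stone_cech :=
  SigSub (mem_set (subset_closure (imageT stone_cech_eval x))).

Definition stone_cech_remainder : topologicalType :=
  set_type (~` range stone_cech_emb).

End stone_cech.

Definition cech_complete (R : realType) (T : topologicalType) : Prop :=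
  tychonoff_space T /\ Gdelta (range (@stone_cech_emb R T)).

(* "X is a subspace of T" is rendered by an embedding of X into T, so that
   "fixing X pointwise" becomes commutation with the embeddings. *)
Record one_point_extension (X : topologicalType) := OnePointExtension {
  ext_space :> topologicalType;
  ext_emb : X -> ext_space;
  ext_tychonoff : tychonoff_space ext_space;
  ext_embedding : topological_embedding ext_emb;
  ext_dense : dense (range ext_emb);
  ext_singleton : exists p : ext_space, ~` range ext_emb = [set p] }.

Section extensions.
Variable X : topologicalType.
Implicit Types T : one_point_extension X.

Definition ext_equiv T1 T2 : Prop :=
  exists2 f : T1 -> T2, homeomorphism f &
    forall x, f (ext_emb T1 x) = ext_emb T2 x.

Definition ext_le T2 T1 : Prop :=
  exists2 f : T1 -> T2, continuous f &
    forall x, f (ext_emb T1 x) = ext_emb T2 x.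

(* The quotient by ext_equiv, as the type of its equivalence classes. These are
   plain predicates because set lives in a universe below topologicalType. *)
Definition one_point_extensions : Type :=
  {C : one_point_extension X -> Prop | exists T, C = ext_equiv T}.

Definition extensions_le (C2 C1 : one_point_extensions) : Prop :=
  exists T2 T1, [/\ sval C2 T2, sval C1 T1 & ext_le T2 T1].

Definition cech_complete_extensions (R : realType) : Type :=
  {C : one_point_extensions | exists2 T, sval C T & cech_complete R T}.

Definition cech_complete_extensions_le (R : realType)
    (C2 C1 : cech_complete_extensions R) : Prop :=
  extensions_le (sval C2) (sval C1).

End extensions.

Definition order_isomorphic (P Q : Type)
    (leP : P -> P -> Prop) (leQ : Q -> Q -> Prop) : Prop :=
  exists2 f : P -> Q, bijective f & forall x y, leP x y <-> leQ (f x) (f y).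

(* Main.v *)
Require Import Defs.
From mathcomp Require Import all_boot all_order all_algebra.
From mathcomp Require Import all_classical all_reals topology normedtype.
From mathcomp Require Import borel_hierarchy.

Set Implicit Arguments.
Unset Strict Implicit.
Unset Printing Implicit Defensive.

Import Order.TTheory GRing.Theory Num.Theory.
Import numFieldNormedType.Exports.

Local Open Scope classical_set_scope.
Local Open Scope ring_scope.

(** Write X* for the remainder of X in beta X; it is compact because X is
    locally compact, hence open in beta X.  The inclusion of X into a one-point
    extension T extends to a continuous surjection [ext_map T] from beta X onto
    beta T.  Its fibre over a point of X is that point alone
    ([stone_cech_map_fiber]), so its fibre over the added point is a nonempty
    closed subset of X*, the trace [ext_trace T] of T.

    The trace determines everything about T that matters here.  First, T2 <= T1
    exactly when the trace of T1 is contained in that of T2 ([ext_leP]): if the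
    inclusion holds, the map from T1 to T2 that fixes X and matches the added
    points is compatible with the two surjections from the compact space beta X,
    which forces it to be continuous ([continuous_compared]).  Secondly, every
    nonempty closed C in X* is a trace ([ext_trace_collapse]), namely that of the
    subspace formed by X and the point C in the quotient of beta X by C.  Thirdly,
    T is Cech-complete exactly when its trace is a G-delta set of X*
    ([cech_complete_ext_trace]), because the complement of T in beta T is the
    image of the complement of the trace in X*.  So the extensions of X,
    respectively the Cech-complete ones, are anti-isomorphic to the nonempty
    closed sets, respectively the nonempty closed G-delta sets, of X*.

    A homeomorphism of remainders clearly induces isomorphisms of these posets.
    Conversely each of them determines the compact Hausdorff space X*
    ([separating_order_isomorphic]).  Two members meet exactly when they have a
    common lower bound, so by compactness an order isomorphism sends the members
    containing a given point to sets with a common point; since the members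
    separate points, going back and forth shows that this common point is unique
    and depends bijectively on the first one.  The members are a base for
    the closed sets, hence the bijection is a homeomorphism. *)

(** * Order isomorphisms *)
Section order_iso.

Lemma inj_surj_bijective (A B : Type) (f : A -> B) :
  injective f -> (forall b, exists a, f a = b) -> bijective f.
Proof.
move=> fI /choice[g gK]; exists g => [a|b]; last exact: gK.
by apply: fI; rewrite gK.
Qed.

Lemma order_isomorphic_sym (P Q : Type) (leP : P -> P -> Prop)
    (leQ : Q -> Q -> Prop) :
  order_isomorphic leP leQ -> order_isomorphic leQ leP.
Proof.
move=> [f [g fK gK] fle]; exists g; first by exists f.
by move=> x y; rewrite fle !gK.
Qed.

Lemma order_isomorphic_trans (P Q S : Type) (leP : P -> P -> Prop)
    (leQ : Q -> Q -> Prop) (leS : S -> S -> Prop) :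
  order_isomorphic leP leQ -> order_isomorphic leQ leS ->
  order_isomorphic leP leS.
Proof.
move=> [f fbij fle] [g gbij gle]; exists (g \o f); first exact: bij_comp.
by move=> x y; rewrite fle gle.
Qed.

Lemma order_isomorphic_sub (P Q : Type) (leP : P -> P -> Prop)
    (leQ : Q -> Q -> Prop) (p : P -> Prop) (q : Q -> Prop) (f : P -> Q) :
    bijective f -> (forall x y, leP x y <-> leQ (f x) (f y)) ->
    (forall x, p x <-> q (f x)) ->
  order_isomorphic (fun x y : {x | p x} => leP (sval x) (sval y))
                   (fun x y : {x | q x} => leQ (sval x) (sval y)).
Proof.
move=> [g fK gK] fle pq.
have pg y : q y -> p (g y) by move=> qy; apply/pq; rewrite gK.
exists (fun x => exist q (f (sval x)) ((pq _).1 (svalP x))).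
  exists (fun y => exist p (g (sval y)) (pg _ (svalP y))) => -[x px];
    by apply: eq_exist => /=; rewrite ?fK ?gK.
by move=> x y /=; exact: fle.
Qed.

End order_iso.

(** * Compact spaces recovered from posets of closed sets *)

(** The families are indexed so that both the poset of closed sets and its
    subposet of G-delta sets, an iterated subtype, are instances.  Closure under
    intersections is only asked when the intersection is nonempty, as the empty
    set is not the trace of an extension. *)
Definition separating (K : topologicalType) (P : Type) (a : P -> set K) :=
  [/\ forall p, closed (a p) /\ a p !=set0,
      forall x, exists p, a p x,
      forall p q, a p `&` a q !=set0 -> exists r, a r = a p `&` a q
    & forall E x, closed E -> E !=set0 -> ~ E x ->
        exists2 p, E `<=` a p & ~ a p x].

Section points_from_closed_sets.
Variables (K L : topologicalType) (P Q : Type).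
Variables (a : P -> set K) (b : Q -> set L) (f : P -> Q) (g : Q -> P).

Definition transfers x y := forall p, a p x -> b (f p) y.

(** The sets [a p] containing [x] form a filter base, and a monotone [f] maps it
    to a filter base of closed sets, which has a cluster point by compactness. *)
Lemma transfers_exists : compact [set: L] -> separating a ->
    (forall q, closed (b q) /\ b q !=set0) ->
    (forall p p', a p `<=` a p' -> b (f p) `<=` b (f p')) ->
  forall x, exists y, transfers x y.
Proof.
move=> cptL [_ acov aI _] bcl fmono x.
pose F := filter_from [set p | a p x] (fun p => b (f p)).
have FF : ProperFilter F.
  apply: filter_from_proper; last by move=> p _; exact: (bcl _).2.
  apply: filter_from_filter; first by have [p] := acov x; exists p.
  move=> p q px qx; have [|r rE] := aI p q; first by exists x.
  exists r; first by rewrite /= rE.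
  by rewrite subsetI; split; apply: fmono; rewrite rE => ? [].
have [y [_ Fy]] := cptL F FF filterT.
exists y => p px; have [+ _] := bcl (f p); apply.
by move=> B yB; apply: Fy => //; exists p.
Qed.

(** Since [g] undoes [f], every member that contains [x] contains [x'] as well,
    whereas the family separates distinct points. *)
Lemma transfers_unique x y x' : hausdorff_space K -> separating a ->
    cancel f g -> transfers x y -> (forall q, b q y -> a (g q) x') -> x = x'.
Proof.
move=> hK [_ _ _ asep] fK xy yx'; apply: contrapT => xx'.
have [|||p xp] := asep [set x] x'.
- exact/accessible_closed_set1/hausdorff_accessible.
- by exists x.
- by move=> x'x; apply: xx'.
- by apply; rewrite -(fK p); apply: yx'; apply: xy; apply: xp.
Qed.

End points_from_closed_sets.

(** A nonempty closed set is the intersection of the members of a separating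
    family that contain it, so its preimage is an intersection of closed sets. *)
Lemma transfers_continuous (K L : topologicalType) (P Q : Type)
    (a : P -> set K) (b : Q -> set L) (g : Q -> P) (h : K -> L) :
    (forall p, closed (a p)) -> separating b ->
    (forall x q, b q (h x) <-> a (g q) x) ->
  continuous h.
Proof.
move=> acl [_ _ _ bsep] hP; apply/continuous_closedP => E clE.
have [->|/set0P E0] := eqVneq E set0; first by rewrite preimage_set0; exact: closed0.
suff -> : h @^-1` E = \bigcap_(q in [set q | E `<=` b q]) a (g q).
  exact: closed_bigI.
apply/seteqP; split=> [x Ehx q Eq|x xE].
  by apply/hP; exact: Eq.
apply: contrapT => nEx.
by have [q Eq] := bsep _ _ clE E0 nEx; apply; apply/hP; apply: xE.
Qed.

(** The inclusions are reversed to match the order of extensions, which grow as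
    their traces shrink. *)
Lemma separating_order_isomorphic (K L : topologicalType) (P Q : Type)
    (a : P -> set K) (b : Q -> set L) :
    compact [set: K] -> hausdorff_space K ->
    compact [set: L] -> hausdorff_space L -> separating a -> separating b ->
    order_isomorphic (fun p p' => a p' `<=` a p) (fun q q' => b q' `<=` b q) ->
  homeomorphic K L.
Proof.
move=> cptK hK cptL hL sa sb [f [g fK gK] fle].
have acl := let: And4 h _ _ _ := sa in h.
have bcl := let: And4 h _ _ _ := sb in h.
have fmono p p' : a p `<=` a p' -> b (f p) `<=` b (f p') by move/fle.
have gmono q q' : b q `<=` b q' -> a (g q) `<=` a (g q').
  by move=> qq'; apply/fle; rewrite !gK.
have [h hP] := choice (transfers_exists cptL sa bcl fmono).
have [k kP] := choice (transfers_exists cptK sb acl gmono).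
have hK' : cancel h k.
  by move=> x; apply/esym/(transfers_unique hK sa fK (hP x)); exact: kP.
have kK : cancel k h.
  by move=> y; apply/esym/(transfers_unique hL sb gK (kP y)); exact: hP.
exists h; split; last (exists k; split => //).
- apply: (transfers_continuous (fun p => (acl p).1) sb (g := g)) => x q.
  split=> [hx|gx]; first by rewrite -[x]hK'; exact: kP.
  by rewrite -[q]gK; exact: hP.
- apply: (transfers_continuous (fun q => (bcl q).1) sa (g := f)) => y p.
  split=> [ky|fy]; first by rewrite -[y]kK; exact: hP.
  by rewrite -[p]fK; exact: kP.
Qed.

Definition nonempty_closed (K : topologicalType) :=
  {A : set K | closed A /\ A !=set0}.

Definition Nonempty_closed (K : topologicalType) (A : set K) (clA : closed A)
  (A0 : A !=set0) : nonempty_closed K := exist _ A (conj clA A0).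

Lemma homeomorphic_nonempty_closed (K L : topologicalType) : homeomorphic K L ->
  exists2 f : nonempty_closed K -> nonempty_closed L, bijective f &
    (forall A B, sval B `<=` sval A <-> sval (f B) `<=` sval (f A)) /\
    (forall A, Gdelta (sval A) <-> Gdelta (sval (f A))).
Proof.
move=> [h [ch [k [hK kK ck]]]].
have pushc (S S' : topologicalType) (u : S -> S') (v : S' -> S) :
    continuous v -> forall A : nonempty_closed S,
    closed (v @^-1` sval A).
  by move=> cv [A [clA A0]]; exact: preimage_closed.
have push0 (S S' : topologicalType) (u : S -> S') (v : S' -> S) :
    cancel u v -> forall A : nonempty_closed S, v @^-1` sval A !=set0.
  by move=> uK [A [clA [x Ax]]]; exists (u x); rewrite /preimage /= uK.
have preimK (S S' : Type) (u : S -> S') (v : S' -> S) (A : set S) :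
    cancel u v -> u @^-1` (v @^-1` A) = A.
  by move=> uK; apply/seteqP; split=> x; rewrite /preimage /= uK.
have preimG (S S' : topologicalType) (v : S' -> S) (A : set S) :
    continuous v -> Gdelta A -> Gdelta (v @^-1` A).
  move=> /continuousP cv [O oO ->]; exists (fun n => v @^-1` O n).
    by move=> n; exact: cv.
  by rewrite preimage_bigcap.
exists (fun A => Nonempty_closed (pushc _ _ h k ck A) (push0 _ _ h k hK A)).
  exists (fun A => Nonempty_closed (pushc _ _ k h ch A) (push0 _ _ k h kK A));
    move=> -[A ?]; by apply: eq_exist => /=; rewrite preimK.
split=> [[A ?] [B ?]|[A ?]] /=; split.
- exact: preimage_subset.
- by move/(preimage_subset (f := h)); rewrite !preimK.
- exact: preimG.
- by move/(preimG _ _ _ _ ch); rewrite preimK.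
Qed.

Lemma separating_nonempty_closed (K : topologicalType) : hausdorff_space K ->
  separating (fun A : nonempty_closed K => sval A).
Proof.
move=> hK; split=> [[]//|x|[A [clA _]] [B [clB _]] /= AB|E x clE E0 nEx].
- have cl1 : closed [set x].
    exact/accessible_closed_set1/hausdorff_accessible.
  have x1 : [set x] !=set0 by exists x.
  by exists (Nonempty_closed cl1 x1).
- by exists (Nonempty_closed (closedI clA clB) AB).
- by exists (Nonempty_closed clE E0).
Qed.

(** * Separation and compactness *)

Lemma compact_completely_regular (R : realType) (K : topologicalType) :
  compact [set: K] -> hausdorff_space K -> completely_regular_space K.
Proof.
move=> cptK hK; apply: (@normal_completely_regular R).
  exact: compact_normal.
exact: hausdorff_accessible.
Qed.

(** The set where a Urysohn function equals 1 is closed and a G-delta. *)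
Lemma closed_Gdelta_between (R : realType) (K : topologicalType) (E : set K) x :
    completely_regular_space K -> closed E -> ~ E x ->
  exists A, [/\ closed A, Gdelta A, E `<=` A & ~ A x].
Proof.
move=> crK clE nEx.
have /(@uniform_separatorP _ R)[f [cf _ fx fE]] := crK _ _ clE nEx.
exists (f @^-1` [set 1]); split.
- by apply: preimage_closed.
- exists (fun n => f @^-1` ball (1 : R) n.+1%:R^-1).
    move=> n; apply: open_comp => [y _|]; first exact: cf.
    exact: (ball_open (1 : R) n.+1%:R^-1).
  apply/seteqP; split=> y /=.
    by move=> fy n _; rewrite /= fy; apply: ballxx; rewrite invr_gt0.
  move=> fy; apply: contrapT => /eqP fy1.
  have d0 : 0 < `|1 - f y| by rewrite normr_gt0 subr_eq0 eq_sym.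
  have [n _ /(_ n (leqnn n))] := near_infty_natSinv_lt (interval_inference.PosNum d0).
  by apply/negP; rewrite -leNgt ltW//; exact: (fy n).
- by move=> y Ey; apply: fE; exists y.
- move=> /= fx1; have : [set f x] `<=` [set (0 : R)].
    by move=> _ ->; apply: fx; exists x.
  by move=> /(_ _ erefl)/=; rewrite fx1 => /eqP; rewrite oner_eq0.
Qed.

Lemma separating_nonempty_closed_Gdelta (R : realType) (K : topologicalType) :
    compact [set: K] -> hausdorff_space K ->
  separating (fun A : {A : nonempty_closed K | Gdelta (sval A)} =>
    sval (sval A)).
Proof.
move=> cptK hK.
have crK := compact_completely_regular R cptK hK.
split=> [[[]]//|x|[[A [clA _]] /= gA] [[B [clB _]] /= gB] AB|E x clE E0 nEx].
- have gT : Gdelta [set: K] by apply: open_Gdelta; exact: openT.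
  have T0 : [set: K] !=set0 by exists x.
  by exists (exist (fun A : nonempty_closed K => Gdelta (sval A))
    (Nonempty_closed closedT T0) gT).
- have gAB : Gdelta (A `&` B).
    move: gA gB => [O oO ->] [O' oO' ->]; exists (fun n => O n `&` O' n).
      by move=> n; exact: openI.
    by rewrite bigcapI.
  by exists (exist (fun A : nonempty_closed K => Gdelta (sval A))
    (Nonempty_closed (closedI clA clB) AB) gAB).
- have [A [clA gA EA nAx]] := closed_Gdelta_between R crK clE nEx.
  have A0 : A !=set0 by case: E0 => y /EA; exists y.
  by exists (exist (fun A : nonempty_closed K => Gdelta (sval A))
    (Nonempty_closed clA A0) gA).
Qed.

Lemma closed_image_compact (K A : topologicalType) (q : K -> A) (E : set K) :
  compact [set: K] -> hausdorff_space A -> continuous q -> closed E ->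
  closed (q @` E).
Proof.
move=> cptK hA cq clE; apply: compact_closed => //.
apply: continuous_compact; first exact: continuous_subspaceT.
exact: (subclosed_compact clE cptK).
Qed.

Lemma completely_regular_initial (R : realType) (S : choiceType)
    (T : topologicalType) (f : S -> T) :
  completely_regular_space T -> completely_regular_space (initial_topology f).
Proof.
move=> crT a B clB nBa.
have [V oV VE] : open (~` B) by rewrite openC.
have clV : closed (~` V) by rewrite closedC.
have nfa : ~ (~` V) (f a).
  by apply; have : (~` B) a by []; rewrite -VE.
have /(@uniform_separatorP _ R)[g [cg g01 ga gB]] := crT _ _ clV nfa.
apply/(@uniform_separatorP _ R); exists (g \o f); split.
- move=> x; apply: continuous_comp; [exact: initial_continuous|exact: cg].
- by move=> _ [x _ <-]; apply: g01; exists (f x).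
- by move=> _ [x -> <-]; apply: ga; exists (f a).
- move=> _ [x Bx <-]; apply: gB; exists (f x) => // Vfx.
  by have : (f @^-1` V) x by []; rewrite VE.
Qed.

Lemma locally_compact_tychonoff (R : realType) (X : topologicalType) :
  hausdorff_space X -> locally_compact [set: X] -> tychonoff_space X.
Proof.
by move=> hX lcX; split=> //; exact: (@locally_compact_completely_regular X R).
Qed.

Lemma hausdorff_injective (S T : topologicalType) (f : S -> T) :
  continuous f -> injective f -> hausdorff_space T -> hausdorff_space S.
Proof.
move=> cf fI hT x y xy; apply/fI/hT => A B fxA fyB.
by have [z [? ?]] := xy _ _ (cf _ _ fxA) (cf _ _ fyB); exists (f z).
Qed.

Lemma set_val_injective (T : Type) (A : set T) : injective (@set_val T A).
Proof. by rewrite set_valE; exact: val_inj. Qed.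

Lemma set_val_continuous (T : topologicalType) (A : set T) :
  continuous (@set_val T A).
Proof. exact: initial_continuous. Qed.

Lemma set_typeP (T : Type) (A : set T) (x : A) : A (set_val x).
Proof. by rewrite set_valE; exact: set_mem (valP x). Qed.

Lemma continuous_set_type (S T : topologicalType) (A : set T) (f : S -> A) :
  continuous (set_val \o f) -> continuous f.
Proof. exact: continuous_comp_initial. Qed.

Lemma closed_set_val (T : topologicalType) (A : set T) (B : set A) :
  closed A -> closed B -> closed (set_val @` B).
Proof.
move=> clA clB; have [V oV VE] : open (~` B) by rewrite openC.
rewrite (_ : _ @` _ = A `&` ~` V); first by apply: closedI; rewrite ?closedC.
apply/seteqP; split=> [_ [x Bx <-]|x [Ax nVx]].
  split; first exact: set_typeP.
  by move=> Vx; have : (set_val @^-1` V) x by []; rewrite VE.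
exists (SigSub (mem_set Ax)); last by rewrite set_valE.
apply: contrapT => nB; apply: nVx.
by have : (~` B) (SigSub (mem_set Ax)) by []; rewrite -VE /preimage set_valE.
Qed.

Lemma compact_set_type (T : topologicalType) (A : set T) :
  compact A -> compact [set: A].
Proof.
move=> cptA F PF _.
have FA : (set_val @ F) A.
  by apply: (@filterS _ F _ setT); [move=> z _; exact: set_typeP|exact: filterT].
have [x [Ax Fx]] := cptA (set_val @ F) _ FA.
exists (SigSub (mem_set Ax)); split=> // B C FB [_ [[V oV <-] /= Vx VC]].
have FB' : (set_val @ F) (set_val @` B).
  by apply: (@filterS _ F _ B) FB => z Bz; exists z.
have xV : nbhs x V.
  by apply: open_nbhs_nbhs; split=> //; move: Vx; rewrite /= set_valE.
have [_ [[y By <-] Vy]] := Fx _ _ FB' xV.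
by exists y; split=> //; exact: VC.
Qed.

Lemma prod_continuous (S : topologicalType) (I : eqType)
    (K : I -> topologicalType) (f : S -> prod_topology K) :
  (forall i, continuous (fun x => f x i)) -> continuous f.
Proof.
move=> cf x; apply/cvg_sup => i U /= [_ [[V oV <-]] Vfx /filterS]; apply.
by apply: (cf i x); exact: open_nbhs_nbhs.
Qed.

(** The preimage of an open set [i2 @^-1` O] under [k] is the set of points
    outside the closed image by [q1] of [q2 @^-1` (~` O)].  The universal
    property of quotients does not apply, as [q2] may separate points in the
    fibres of [q1] outside the range of [i1]; compactness of [K] replaces it. *)
Lemma continuous_compared (K T1 T2 A B : topologicalType)
    (q1 : K -> A) (q2 : K -> B) (i1 : T1 -> A) (i2 : T2 -> B) (k : T1 -> T2) :
    compact [set: K] -> hausdorff_space A -> continuous q1 -> continuous q2 ->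
    continuous i1 -> topological_embedding i2 ->
    (forall t, exists z, q1 z = i1 t) ->
    (forall z t, q1 z = i1 t -> q2 z = i2 (k t)) ->
  continuous k.
Proof.
move=> cptK hA cq1 cq2 ci1 [_ ei2] onto1 comp; apply/continuousP => U.
move=> /ei2[O oO UE].
rewrite (_ : k @^-1` U = i1 @^-1` (~` (q1 @` (q2 @^-1` ~` O)))).
  apply: open_comp => [? _|]; first exact: ci1.
  rewrite openC; apply: closed_image_compact => //.
  by apply: preimage_closed; rewrite ?closedC// => ? _; exact: cq2.
apply/seteqP; split=> t.
  rewrite /preimage /= UE => Ot [z] /= nO /comp q2z.
  by apply: nO; rewrite q2z.
rewrite /preimage /= UE => nt; apply: contrapT => nOt.
have [z zt] := onto1 t; apply: nt; exists z => //= .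
by rewrite (comp _ _ zt).
Qed.

(** * The Stone-Cech compactification *)

Section stone_cech_theory.
Variable R : realType.
Local Notation I := (unit_interval R).
Local Notation beta := (stone_cech R).

Lemma unit_interval_compact : compact [set: I].
Proof. exact/compact_set_type/segment_compact. Qed.

Lemma unit_interval_hausdorff : hausdorff_space I.
Proof.
apply: hausdorff_injective (@set_val_injective _ _) (@Rhausdorff R).
exact: set_val_continuous.
Qed.

Lemma unit_intervalP (r : R) : 0 <= r <= 1 -> (`[0, 1]%classic : set R) r.
Proof. by rewrite /= in_itv. Qed.

Definition to_unit (r : R) (r01 : 0 <= r <= 1) : I :=
  (SigSub (mem_set (unit_intervalP r01)) : `[0, 1]%classic).

Lemma zero_in01 : 0 <= (0 : R) <= 1. Proof. by rewrite lexx ler01. Qed.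


Lemma cube_compact (X : topologicalType) : compact [set: stone_cech_cube R X].
Proof.
have := @tychonoff (continuousType X I) (fun=> I) (fun=> setT)
  (fun=> unit_interval_compact).
by congr compact; apply/seteqP; split.
Qed.

Lemma cube_hausdorff (X : topologicalType) : hausdorff_space (stone_cech_cube R X).
Proof. by apply: hausdorff_product => _; exact: unit_interval_hausdorff. Qed.

Lemma stone_cech_compact (X : topologicalType) : compact [set: beta X].
Proof.
apply: compact_set_type; apply: (subclosed_compact _ (@cube_compact X)) => //.
exact: closed_closure.
Qed.

Lemma stone_cech_hausdorff (X : topologicalType) : hausdorff_space (beta X).
Proof.
apply: hausdorff_injective (@set_val_injective _ _) (@cube_hausdorff X).
exact: set_val_continuous.
Qed.

(** This is the extension of [f] to the Stone-Cech compactification. *)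
Definition coordinate (X : topologicalType) (f : continuousType X I)
  (z : beta X) : I :=
  set_val z f.

Lemma coordinate_emb (X : topologicalType) (f : continuousType X I) (x : X) :
  coordinate f (stone_cech_emb R x) = f x.
Proof. by rewrite /coordinate set_valE. Qed.

Lemma stone_cech_eq (X : topologicalType) (z z' : beta X) :
  (forall f, coordinate f z = coordinate f z') -> z = z'.
Proof.
move=> zz'; apply: set_val_injective; exact: functional_extensionality_dep.
Qed.

Lemma coordinate_continuous (X : topologicalType) (f : continuousType X I) :
  continuous (coordinate f).
Proof.
move=> z; apply: (@continuous_comp (beta X) (stone_cech_cube R X) I set_val
  (fun h : stone_cech_cube R X => h f) z).
  exact: set_val_continuous.
exact: (@proj_continuous _ (fun=> I) f).
Qed.

Lemma continuous_stone_cech (S X : topologicalType) (k : S -> beta X) :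
  (forall f, continuous (coordinate f \o k)) -> continuous k.
Proof.
by move=> ck; apply: continuous_set_type; apply: prod_continuous => f; exact: ck.
Qed.

Lemma stone_cech_emb_continuous (X : topologicalType) :
  continuous (@stone_cech_emb R X).
Proof.
apply: continuous_stone_cech => f.
rewrite (_ : _ \o _ = f); first exact: cts_fun.
by apply/funext => x; rewrite /= coordinate_emb.
Qed.

Lemma stone_cech_emb_dense (X : topologicalType) :
  dense (range (@stone_cech_emb R X)).
Proof.
move=> O [z Oz] oO; have [V oV VE] := oO.
have zV : nbhs (set_val z) V.
  by apply: open_nbhs_nbhs; split => //; move: Oz; rewrite -VE.
have [_ [[x _ <-] Vx]] := set_typeP z V zV.
by exists (stone_cech_emb R x); split; [rewrite -VE /preimage /= set_valE|exists x].
Qed.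
End stone_cech_theory.

Lemma eq_on_dense (S H : topologicalType) (D : set S) (f g : S -> H) :
  hausdorff_space H -> dense D -> continuous f -> continuous g ->
  (forall x, D x -> f x = g x) -> f = g.
Proof.
move=> hH dD cf cg fg; apply/funext => z; apply: hH => A B fzA gzB.
have zAB : nbhs z (f @^-1` A `&` g @^-1` B) by apply: filterI; [exact: cf|exact: cg].
have [] := dD (f @^-1` A `&` g @^-1` B)°; first by exists z.
  exact: open_interior.
move=> x [/interior_subset[Afx Bgx] Dx]; exists (f x); split => //.
by rewrite fg.
Qed.

Lemma topological_embedding_continuous (S T : topologicalType) (e : S -> T) :
  topological_embedding e -> continuous e.
Proof. by move=> [_ eE]; apply/continuousP => V oV; apply/eE; exists V. Qed.

Section stone_cech_functor.
Variable R : realType.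
Local Notation I := (unit_interval R).
Local Notation beta := (stone_cech R).
Local Notation emb := (@stone_cech_emb R _).

Lemma set_val_to_unit (r : R) (r01 : 0 <= r <= 1) : set_val (to_unit r01) = r.
Proof. by rewrite set_valE. Qed.

Lemma unit_valued (T : topologicalType) (g : T -> R) : continuous g ->
  range g `<=` `[0, 1] ->
  exists h : continuousType T I, forall t, set_val (h t) = g t.
Proof.
move=> cg g01; have g01' t : 0 <= g t <= 1.
  by have := g01 (g t); rewrite /= in_itv; apply; exists t.
have ch : continuous (fun t => to_unit (g01' t)).
  apply: continuous_set_type; rewrite (_ : _ \o _ = g); first exact: cg.
  by apply/funext => t /=; rewrite set_val_to_unit.
by exists (mkcts ch) => t; rewrite /mkcts set_val_to_unit.
Qed.

Lemma unit_separation (T : topologicalType) (t : T) (B : set T) :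
  completely_regular_space T -> closed B -> ~ B t ->
  exists h : continuousType T I, set_val (h t) = 0 /\
    forall b, B b -> set_val (h b) = 1.
Proof.
move=> crT clB nBt.
have /(@uniform_separatorP _ R)[g [cg g01 gt gB]] := crT _ _ clB nBt.
have [h hE] := unit_valued cg g01; exists h; rewrite hE; split.
  by apply: gt; exists t.
by move=> b Bb; rewrite hE; apply: gB; exists b.
Qed.

Lemma closed_coordinate_eq (X : topologicalType) (f : continuousType X I) (r : R) :
  closed [set z : beta X | set_val (coordinate f z) = r].
Proof.
rewrite (_ : [set _ | _] = (set_val \o coordinate f) @^-1` [set r])//.
apply: preimage_closed => [z _|].
  by apply: continuous_comp; [exact: coordinate_continuous|exact: set_val_continuous].
exact/accessible_closed_set1/hausdorff_accessible/Rhausdorff.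
Qed.

Lemma coordinate_unique (X : topologicalType) (f : continuousType X I) (g : beta X -> I) :
  continuous g -> (forall x, g (emb x) = f x) -> coordinate f = g.
Proof.
move=> cg gf; apply: (@eq_on_dense (beta X) _ _ _ _ (@unit_interval_hausdorff R)
  (@stone_cech_emb_dense R X)) => //; first exact: coordinate_continuous.
by move=> _ [x _ <-]; rewrite coordinate_emb gf.
Qed.

(** A separating function on the compact space beta X is the coordinate
    of its restriction to X, since both agree on the dense image of X. *)
Lemma coordinate_separation (X : topologicalType) (z : beta X) (D : set (beta X)) :
  closed D -> ~ D z ->
  exists f : continuousType X I, set_val (coordinate f z) = 0 /\
    forall d, D d -> set_val (coordinate f d) = 1.
Proof.
move=> clD nDz.
have crb := compact_completely_regular R (@stone_cech_compact R X)
  (@stone_cech_hausdorff R X).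
have [h [hz hD]] := unit_separation crb clD nDz.
pose e : continuousType X (beta X) := mkcts (@stone_cech_emb_continuous R X).
exists (h \o e); rewrite (@coordinate_unique _ _ h) //; exact: cts_fun.
Qed.

(** An open [U] is the trace of the complement of the closure of [~` U] in
    beta X: a function that is 0 at a point of [U] and 1 off [U] extends, and its
    extension is still 1 on that closure. *)
Lemma stone_cech_emb_embedding (X : topologicalType) :
  tychonoff_space X -> topological_embedding (@stone_cech_emb R X).
Proof.
move=> [crX hX]; split=> [x y xy|U]; last first.
  split=> [oU|[V oV ->]]; last first.
    by apply: open_comp => // x _; exact: stone_cech_emb_continuous.
  exists (~` closure (emb @` (~` U))); first exact/closed_openC/closed_closure.
  apply/seteqP; split=> [x Ux|x]; rewrite /preimage /=; last first.
    by move=> ncl; apply: contrapT => nUx; apply/ncl/subset_closure; exists x.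
  have clU : closed (~` U) by rewrite closedC.
  have nUx : ~ (~` U) x by apply.
  have [h [hx hU]] := unit_separation crX clU nUx.
  have hE : emb @` (~` U) `<=` [set z | set_val (coordinate h z) = 1 :> R].
    by move=> _ [y nUy <-] /=; rewrite coordinate_emb hU.
  move=> /(closureS hE)/(@closed_coordinate_eq _ h 1)/=.
  by rewrite coordinate_emb hx => /eqP; rewrite eq_sym oner_eq0.
apply: contrapT => nxy.
have cly : closed [set y] by exact/accessible_closed_set1/hausdorff_accessible.
have [h [hx hy]] := unit_separation crX cly nxy.
have := hx; rewrite -coordinate_emb xy coordinate_emb hy// => /eqP.
  by rewrite oner_eq0.
Qed.

Section map.
Variables (X T : topologicalType) (e : continuousType X T).

(** Pulling functions back along [e] is continuous on the cubes and sends
    evaluations to evaluations, hence preserves the closures of their ranges. *)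
Lemma stone_cech_map_subproof (z : beta X) :
  closure (range (@stone_cech_eval R T))
    (fun h : continuousType T I => coordinate (h \o e) z).
Proof.
pose m (z : beta X) : stone_cech_cube R T := fun h => coordinate (h \o e) z.
have cm : continuous m.
  by apply: prod_continuous => h; exact: coordinate_continuous.
move=> B mzB; have zB : nbhs z (m @^-1` B) by exact: cm.
have [] := @stone_cech_emb_dense R X (m @^-1` B)°; first by exists z.
  exact: open_interior.
move=> _ [/[swap] -[x _ <-] /interior_subset mB]; exists (m (emb x)).
by split; [exists (e x)|].
Qed.

Definition stone_cech_map (z : beta X) : beta T :=
  SigSub (mem_set (@stone_cech_map_subproof z)).

Lemma coordinate_map (h : continuousType T I) (z : beta X) :
  coordinate h (stone_cech_map z) = coordinate (h \o e) z.
Proof. by rewrite /coordinate set_valE. Qed.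

Lemma stone_cech_map_continuous : continuous stone_cech_map.
Proof.
apply: continuous_stone_cech => h.
rewrite (_ : _ \o _ = coordinate (h \o e)); first exact: coordinate_continuous.
by apply/funext => z; rewrite /= coordinate_map.
Qed.

Lemma stone_cech_map_emb (x : X) : stone_cech_map (emb x) = emb (e x).
Proof. by apply: stone_cech_eq => h; rewrite coordinate_map !coordinate_emb. Qed.

Lemma stone_cech_map_surjective : dense (range e) ->
  forall u, exists z, stone_cech_map z = u.
Proof.
move=> de u; apply: contrapT => nu.
have clim : closed (range stone_cech_map).
  apply: closed_image_compact closedT.
  - exact: stone_cech_compact.
  - exact: stone_cech_hausdorff.
  - exact: stone_cech_map_continuous.
have oim : open (~` range stone_cech_map) by rewrite openC.
have im0 : ~` range stone_cech_map !=set0.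
  by exists u => -[z _ zu]; apply: nu; exists z.
have [_ [/[swap] -[t _ <-] nt]] := stone_cech_emb_dense im0 oim.
have oT : open (emb @^-1` (~` range stone_cech_map) : set T).
  by apply: open_comp oim => ? _; exact: stone_cech_emb_continuous.
have [_ [/[swap] -[x _ <-] nx]] := de _ (ex_intro _ t nt) oT.
by apply: nx; exists (emb x) => //; exact: stone_cech_map_emb.
Qed.

(** If [z] differs from [emb x], separate them by disjoint open sets [A] and [W].
    The trace of [W] on X is the trace of an open set [O] of T, and a function [h]
    on T with value 0 at [e x] and 1 off [O] takes the value 1 on the points of X
    in [A], so its pullback takes the value 1 at [z] and not the value
    [h (e x)]. *)
Lemma stone_cech_map_fiber (z : beta X) (x : X) :
    tychonoff_space T -> topological_embedding e ->
  stone_cech_map z = emb (e x) -> z = emb x.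
Proof.
move=> [crT _] [_ eE] zx; apply: contrapT => nzx.
have := @stone_cech_hausdorff R X; rewrite open_hausdorff.
move=> /(_ z (emb x))[|[A W] /= []]; first exact/eqP.
rewrite !inE => Az Wx [oA oW AW].
have : open (emb @^-1` W : set X).
  by apply: open_comp => // ? _; exact: stone_cech_emb_continuous.
move=> /eE[O oO OE].
have Oex : O (e x) by have : (emb @^-1` W) x by []; rewrite OE.
have clO : closed (~` O) by rewrite closedC.
have nOex : ~ (~` O) (e x) by apply.
have [h [hx hO]] := unit_separation crT clO nOex.
have hz : set_val (coordinate (h \o e) z) = 0 :> R.
  by rewrite -coordinate_map zx coordinate_emb.
(* [h \o e] is not 1 near [z], yet it is 1 at the points of X in [A]. *)
pose N := A `&` ~` [set u | set_val (coordinate (h \o e) u) = 1 :> R].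
have N0 : N !=set0.
  by exists z; split=> //=; rewrite hz => /eqP; rewrite eq_sym oner_eq0.
have oN : open N by apply: openI; rewrite // openC; exact: closed_coordinate_eq.
have [_ [/[swap] -[y _ <-] [Ay ny]]] := stone_cech_emb_dense N0 oN.
apply: ny => /=; rewrite coordinate_emb /= hO// => Oey.
have : (e @^-1` O) y by []; rewrite -OE => Wy.
by have : (A `&` W) (emb y) by []; rewrite AW.
Qed.

End map.

Lemma stone_cech_map_comp (X T T' : topologicalType) (e : continuousType X T)
    (e' : continuousType X T') (k : continuousType T T') (z : beta X) :
  (forall x, k (e x) = e' x) ->
  stone_cech_map k (stone_cech_map e z) = stone_cech_map e' z.
Proof.
move=> ke; apply: stone_cech_eq => h; rewrite !coordinate_map; congr (coordinate _ z).
by apply/continuousEP => x /=; rewrite ke.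
Qed.

End stone_cech_functor.

(** * The trace of a one-point extension *)

Section trace.
Variables (R : realType) (X : topologicalType).
Local Notation I := (unit_interval R).
Local Notation beta := (stone_cech R).
Local Notation emb := (@stone_cech_emb R _).
Local Notation remainder := (stone_cech_remainder R X).
Implicit Types T : one_point_extension X.

Definition ext_embedding_map T : continuousType X T :=
  mkcts (topological_embedding_continuous (ext_embedding T)).

Definition ext_map T : beta X -> beta T := stone_cech_map (ext_embedding_map T).

(** This is the fibre of [ext_map T] over the added point, described without
    choosing a name for that point: by [ext_map_fiber], no point of the remainder
    is sent to a point of X. *)
Definition ext_trace T : set remainder :=
  [set w | range (@stone_cech_emb R T) (ext_map T (set_val w))].

Lemma ext_map_continuous T : continuous (ext_map T).
Proof. exact: stone_cech_map_continuous. Qed.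

Lemma ext_map_emb T (x : X) : ext_map T (emb x) = emb (ext_emb T x).
Proof. exact: stone_cech_map_emb. Qed.

Lemma ext_map_surjective T u : exists z, ext_map T z = u.
Proof. exact/stone_cech_map_surjective/ext_dense. Qed.

Lemma ext_map_fiber T (z : beta X) (x : X) :
  ext_map T z = emb (ext_emb T x) -> z = emb x.
Proof.
by apply: stone_cech_map_fiber; [exact: ext_tychonoff|exact: ext_embedding].
Qed.

Lemma stone_cech_emb_inj T : injective (@stone_cech_emb R T).
Proof. by case: (stone_cech_emb_embedding R (ext_tychonoff T)). Qed.

Lemma remainderP (w : remainder) (x : X) : set_val w <> emb x.
Proof. by move=> wx; apply: (set_typeP w); exists x. Qed.

Lemma remainder_onto (z : beta X) : ~ range (@stone_cech_emb R X) z ->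
  exists w : remainder, set_val w = z.
Proof.
move=> nz; have {}nz : (~` range (@stone_cech_emb R X)) z by [].
by exists (SigSub (mem_set nz)); rewrite set_valE.
Qed.

Variant ext_point_spec T (p t : T) : Prop :=
  | ExtBase x of t = ext_emb T x
  | ExtNew of t = p & ~ range (ext_emb T) t.

Lemma ext_pointP T : exists2 p : T, ~ range (ext_emb T) p &
  forall t, ext_point_spec p t.
Proof.
have [p pE] := ext_singleton T; exists p; first by rewrite -[~ _]/((~` _) p) pE.
move=> t; have [[x _ <-]|nt] := pselect (range (ext_emb T) t).
  exact: ExtBase erefl.
by apply: ExtNew => //; have : (~` range (ext_emb T)) t by []; rewrite pE.
Qed.

Lemma ext_trace_new T (p : T) (z : beta X) : ~ range (ext_emb T) p ->
  ext_map T z = emb p -> exists2 w, ext_trace T w & set_val w = z.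
Proof.
move=> np zp; have [|w wz] := @remainder_onto z.
  move=> [x _ xz]; apply: np; exists x => //; apply: stone_cech_emb_inj.
  by rewrite -zp -xz ext_map_emb.
by exists w => //; exists p => //; rewrite wz.
Qed.

Lemma ext_trace_closed T : closed (ext_trace T) /\ ext_trace T !=set0.
Proof.
have [p np pP] := ext_pointP T; split; last first.
  have [z zp] := ext_map_surjective (emb p).
  by have [w wT _] := ext_trace_new np zp; exists w.
rewrite (_ : ext_trace T = (ext_map T \o set_val) @^-1` [set emb p]).
  apply: preimage_closed => [w _|].
    by apply: continuous_comp; [exact: set_val_continuous|exact: ext_map_continuous].
  exact/accessible_closed_set1/hausdorff_accessible/stone_cech_hausdorff.
apply/seteqP; split=> w /=; last by move=> wp; exists p.
move=> [t _ tw]; have [x tx|<- _] := pP t; last by rewrite tw.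
by case: (@remainderP w x); apply: (@ext_map_fiber T); rewrite -tw tx.
Qed.

Definition closed_ext_trace T : nonempty_closed remainder :=
  exist _ (ext_trace T) (ext_trace_closed T).

(** A map from T1 to T2 over X carries the extension [ext_map T1] to [ext_map T2],
    so a point sent into T1 is sent into T2.  For the converse, the inclusion
    says that [ext_map T2] sends the whole fibre over the new point of T1 to the
    new point of T2, which gives the compatibility required by
    [continuous_compared]. *)
Lemma ext_leP T1 T2 : ext_le T2 T1 <-> ext_trace T1 `<=` ext_trace T2.
Proof.
split=> [[k ck ke] w [t _ tw]|T12].
  exists (k t) => //; rewrite /ext_map.
  rewrite -(@stone_cech_map_comp R _ _ _ (ext_embedding_map T1) _ (mkcts ck))//.
  by rewrite -[X in stone_cech_map _ X]tw stone_cech_map_emb.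
have [p1 np1 p1P] := ext_pointP T1; have [p2 np2 p2P] := ext_pointP T2.
have /choice[k kP] t : exists t' : T2,
    (forall z, ext_map T1 z = emb t -> ext_map T2 z = emb t') /\
    (forall x, t = ext_emb T1 x -> t' = ext_emb T2 x).
  have [x ->|-> _] := p1P t.
    exists (ext_emb T2 x); split=> [z /ext_map_fiber ->|y].
      by rewrite ext_map_emb.
    by case: (ext_embedding T1) => eI _ /eI ->.
  exists p2; split=> [z zp1|x p1x]; last by case: np1; exists x.
  have [w w1 <-] := ext_trace_new np1 zp1.
  have [t' _ tw] := T12 _ w1.
  have [x tx|tp _] := p2P t'; last by rewrite -tw tp.
  by case: (@remainderP w x); apply: (@ext_map_fiber T2); rewrite -tw tx.
exists k => [|x]; last exact: (kP _).2.
apply: (continuous_compared (q1 := ext_map T1) (q2 := ext_map T2)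
  (i1 := @stone_cech_emb R T1) (i2 := @stone_cech_emb R T2)).
- exact: stone_cech_compact.
- exact: stone_cech_hausdorff.
- exact: ext_map_continuous.
- exact: ext_map_continuous.
- exact: stone_cech_emb_continuous.
- exact/stone_cech_emb_embedding/ext_tychonoff.
- by move=> t; exact: ext_map_surjective.
- by move=> z t; exact: (kP _).1.
Qed.

Lemma ext_le_cancel T1 T2 (k : T1 -> T2) (k' : T2 -> T1) :
    continuous k -> (forall x, k (ext_emb T1 x) = ext_emb T2 x) ->
    continuous k' -> (forall x, k' (ext_emb T2 x) = ext_emb T1 x) ->
  cancel k k'.
Proof.
move=> ck ke ck' ke'.
suff kk : k' \o k = id by move=> t; exact: (congr1 (@^~ t) kk).
apply: (@eq_on_dense T1 _ (range (ext_emb T1))).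
- exact: (ext_tychonoff T1).2.
- exact: ext_dense.
- by move=> t; apply: continuous_comp; [exact: ck|exact: ck'].
- by move=> t.
- by move=> _ [x _ <-]; rewrite /= ke ke'.
Qed.

Lemma ext_equivP T1 T2 : ext_equiv T1 T2 <-> ext_trace T1 = ext_trace T2.
Proof.
split=> [[k [ck [k' [kK k'K ck']]] ke]|T12].
  apply/seteqP; split; apply/ext_leP; first by exists k.
  by exists k' => // x; rewrite -ke kK.
have [k ck ke] : ext_le T2 T1 by apply/ext_leP; rewrite T12.
have [k' ck' ke'] : ext_le T1 T2 by apply/ext_leP; rewrite T12.
exists k => //; split=> //; exists k'; split=> //.
  exact: (ext_le_cancel ck ke ck' ke').
exact: (ext_le_cancel ck' ke' ck ke).
Qed.

End trace.

(** A compact neighbourhood [U] of [x] has a closed image in beta X.  If [W] is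
    open in beta X with the interior of [U] as its trace, then [W] lies in the
    closure of its trace by density, hence in the image of [U]. *)
Lemma locally_compact_remainder_closed (R : realType) (X : topologicalType) :
  hausdorff_space X -> locally_compact [set: X] ->
  closed (~` range (@stone_cech_emb R X)).
Proof.
move=> hX lcX; rewrite closedC openE => _ [x _ <-].
have [U] := lcX x I; rewrite withinET => xU [cptU _].
have tX := locally_compact_tychonoff R hX lcX.
have [_ embE] := stone_cech_emb_embedding R tX.
have : open U° by exact: open_interior.
move=> /embE[W oW WE].
have Wx : W (stone_cech_emb R x).
  by have : (U°) x by []; rewrite WE.
apply: (@filterS _ (nbhs (stone_cech_emb R x)) _ W); last first.
  exact: open_nbhs_nbhs.
have clU : closed (@stone_cech_emb R X @` U).
  apply: compact_closed; first exact: stone_cech_hausdorff.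
  apply: continuous_compact cptU; apply: continuous_subspaceT.
  exact: stone_cech_emb_continuous.
move=> z Wz; suff [y _ yz] : (@stone_cech_emb R X @` U) z by exists y.
apply: clU => N zN.
have zNW : nbhs z (N `&` W) by apply: filterI => //; exact: open_nbhs_nbhs.
have [] := @stone_cech_emb_dense R X (N `&` W)°; first by exists z.
  exact: open_interior.
move=> _ [/[swap] -[y _ <-] /interior_subset[Ny Wy]].
exists (stone_cech_emb R y); split=> //; exists y => //.
by apply: interior_subset; rewrite WE.
Qed.

(** * Cech-completeness and the realization of closed sets as traces *)

Section realization.
Variables (R : realType) (X : topologicalType).
Local Notation I := (unit_interval R).
Local Notation beta := (stone_cech R).
Local Notation emb := (@stone_cech_emb R _).
Local Notation remainder := (stone_cech_remainder R X).
Hypothesis tX : tychonoff_space X.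
Hypothesis clX : closed (~` range (@stone_cech_emb R X)).

Lemma remainder_compact : compact [set: remainder].
Proof.
apply: compact_set_type; apply: subclosed_compact clX (@stone_cech_compact R X) _.
exact: subsetT.
Qed.

Lemma remainder_hausdorff : hausdorff_space remainder.
Proof.
apply: hausdorff_injective (@set_val_injective _ _) (@stone_cech_hausdorff R X).
exact: set_val_continuous.
Qed.

(** The trace is the preimage of T under [ext_map T], so it is a G-delta if T is
    one in beta T.  Conversely, if it is the intersection of the open sets [G n],
    the images of the compact sets [~` G n] are closed and cover the complement
    of T in beta T. *)
Lemma cech_complete_ext_trace (T : one_point_extension X) :
  cech_complete R T <-> Gdelta (@ext_trace R X T).
Proof.
split=> [[_ [O oO OE]]|[G oG GE]].
  exists (fun n => (ext_map T \o set_val) @^-1` O n).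
    move=> n; apply: open_comp => // w _.
    by apply: continuous_comp; [exact: set_val_continuous|exact: ext_map_continuous].
  by rewrite -preimage_bigcap -OE.
split; first exact: ext_tychonoff.
exists (fun n => ~` (ext_map T @` (set_val @` (~` G n)))).
  move=> n; rewrite openC; apply: closed_image_compact.
  - exact: stone_cech_compact.
  - exact: stone_cech_hausdorff.
  - exact: ext_map_continuous.
  - by apply: closed_set_val => //; rewrite closedC; exact: oG.
apply/seteqP; split=> [u uT n _ [_ [w nGw <-] wu]|u uG].
  have : @ext_trace R X T w by rewrite /ext_trace /= wu.
  by rewrite GE => /(_ n Logic.I).
have [z zu] := ext_map_surjective u.
have [[x _ xz]|nz] := pselect (range (@stone_cech_emb R X) z).
  by exists (ext_emb T x) => //; rewrite -zu -xz ext_map_emb.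
have [w wz] := remainder_onto nz.
suff : @ext_trace R X T w by rewrite /ext_trace /= wz zu.
rewrite GE => n _; apply: contrapT => nGw; apply: (uG n) => //.
by exists z => //; exists w.
Qed.

Section collapse.
Variable C : nonempty_closed remainder.

Let D : set (beta X) := set_val @` sval C.

Let clD : closed D. Proof. by apply: closed_set_val => //; case: (svalP C). Qed.

Let D0 : exists z, D z.
Proof. by case: (svalP C) => _ [w Cw]; exists (set_val w), w. Qed.

Let d0 := sval (cid D0).
Let Dd0 : D d0 := svalP (cid D0).

Let D_emb x : ~ D (emb x).
Proof. by move=> [w _ /remainderP]. Qed.

Definition constant_on (f : continuousType X I) :=
  forall z z', D z -> D z' -> coordinate f z = coordinate f z'.

(** A model of the quotient of beta X by [D]: only the coordinates that are
    constant on [D] are kept, the others being replaced by 0, so that [D] becomes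
    a point and, by complete regularity, nothing else is identified. *)
Definition collapse (z : beta X) : stone_cech_cube R X := fun f =>
  if `[< constant_on f >] then coordinate f z else to_unit (zero_in01 R).

Lemma collapse_const f z : constant_on f -> collapse z f = coordinate f z.
Proof. by rewrite /collapse => /asboolT ->. Qed.

Lemma collapse_continuous : continuous collapse.
Proof.
apply: prod_continuous => f; rewrite /collapse; case: `[< _ >] => z.
  exact: coordinate_continuous.
exact: cst_continuous.
Qed.

Lemma collapse_D z z' : D z -> D z' -> collapse z = collapse z'.
Proof.
move=> Dz Dz'; apply: functional_extensionality_dep => f.
by rewrite /collapse; case: asboolP => //; apply.
Qed.

Lemma collapse_inj z z' : ~ D z -> collapse z = collapse z' -> z = z'.
Proof.
move=> nDz zz'; apply: contrapT => nzz'.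
have clE : closed (D `|` [set z']).
  apply: closedU => //.
  exact/accessible_closed_set1/hausdorff_accessible/stone_cech_hausdorff.
have nEz : ~ (D `|` [set z']) z by move=> [//|].
have [f [fz fE]] := coordinate_separation clE nEz.
have fc : constant_on f.
  by move=> y y' Dy Dy'; apply: set_val_injective; rewrite !fE//; left.
have : set_val (coordinate f z) = set_val (coordinate f z').
  by rewrite -!collapse_const// zz'.
by rewrite fz fE => [/eqP|]; [rewrite eq_sym oner_eq0|right].
Qed.

Lemma collapse_separation z : ~ D z ->
  exists2 f, constant_on f & forall d, D d -> coordinate f z <> coordinate f d.
Proof.
move=> nDz; have [f [fz fD]] := coordinate_separation clD nDz; exists f.
  by move=> y y' Dy Dy'; apply: set_val_injective; rewrite !fD.
move=> d Dd fzd; have := fD _ Dd; rewrite -fzd fz => /eqP.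
by rewrite eq_sym oner_eq0.
Qed.

(** The points of X together with the point to which [D] is collapsed. *)
Definition adjoin (t : option X) : stone_cech_cube R X :=
  if t is Some x then collapse (emb x) else collapse d0.

Definition adjunction : topologicalType := initial_topology adjoin.

Lemma adjoin_continuous : continuous (adjoin : adjunction -> _).
Proof. exact: initial_continuous. Qed.

Lemma adjoin_inj : injective adjoin.
Proof.
have inj x : collapse (emb x) <> collapse d0.
  move/collapse_inj => /(_ (@D_emb x)) xd; apply: (@D_emb x).
  by rewrite xd.
move=> [x|] [y|] //= => [/collapse_inj xy|/inj//|/esym/inj//].
congr Some; apply: (stone_cech_emb_embedding R tX).1; exact: xy.
Qed.

Lemma adjunction_tychonoff : tychonoff_space adjunction.
Proof.
split; last exact: hausdorff_injective adjoin_continuous adjoin_inj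
  (@cube_hausdorff R X).
apply: (completely_regular_initial R).
apply: (compact_completely_regular R); first exact: cube_compact.
exact: cube_hausdorff.
Qed.

(** An open set of X is the trace of an open set [W] of beta X, which may be
    taken disjoint from [D].  Then [W] is saturated for [collapse], and the
    complement of the image of [~` W] is open. *)
Lemma adjunction_embedding : topological_embedding (Some : X -> adjunction).
Proof.
split=> [x y []//|U]; split=> [oU|[_ [V oV <-] ->]]; last first.
  apply: (open_comp (f := collapse \o emb)) => // x _.
  apply: continuous_comp; first exact: stone_cech_emb_continuous.
  exact: collapse_continuous.
have [_ embE] := stone_cech_emb_embedding R tX.
have [W oW WE] := (embE U).1 oU.
exists (adjoin @^-1` ~` (collapse @` ~` (W `&` ~` D))).
  exists (~` (collapse @` ~` (W `&` ~` D))) => //.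
  rewrite openC; apply: closed_image_compact.
  - exact: stone_cech_compact.
  - exact: cube_hausdorff.
  - exact: collapse_continuous.
  - by rewrite closedC; apply: openI => //; rewrite openC.
rewrite WE; apply/seteqP; split=> x /=; rewrite /preimage /=.
  move=> Wx [z nz /esym/collapse_inj] => /(_ (@D_emb x)) xz.
  by apply: nz; rewrite -xz; split=> //; exact: D_emb.
move=> nx; apply: contrapT => nWx; apply: nx; exists (emb x) => //.
by move=> [].
Qed.

Lemma adjunction_dense : dense (range (Some : X -> adjunction)).
Proof.
move=> O [[x|] Ox] oO; first by exists (Some x); split=> //; exists x.
have [V oV VE] := oO.
have oV' : open (collapse @^-1` V).
  by apply: open_comp => // z _; exact: collapse_continuous.
have Vd : (collapse @^-1` V) d0 by move: Ox; rewrite -VE.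
have [_ [/[swap] -[x _ <-] Vx]] := stone_cech_emb_dense (ex_intro _ _ Vd) oV'.
by exists (Some x); split; [rewrite -VE|exists x].
Qed.

Lemma adjunction_singleton :
  exists p : adjunction, ~` range (Some : X -> adjunction) = [set p].
Proof.
exists None; apply/seteqP; split=> [[x|] //= nx|_ -> [x _]//].
by case: nx; exists x.
Qed.

Definition collapse_extension : one_point_extension X :=
  OnePointExtension adjunction_tychonoff adjunction_embedding adjunction_dense
    adjunction_singleton.

(** If [w] is not in [C], a coordinate constant on [D] separates it from [D]; this
    coordinate is the restriction to X of a function on the extension, which
    separates the image of [w] from the new point.  If [w] is in [C], every
    neighbourhood of [w] meets X in points close to the new point, so no function
    on the extension can separate the image of [w] from the new point. *)
Lemma ext_trace_collapse : @ext_trace R X collapse_extension = sval C.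
Proof.
apply/seteqP; split=> w.
  move=> [[x|] _ xw].
    by case: (@remainderP _ _ w x); apply: (@ext_map_fiber _ _ collapse_extension).
  apply: contrapT => nCw.
  have nDw : ~ D (set_val w).
    by move=> [w' Cw' /set_val_injective w'w]; apply: nCw; rewrite -w'w.
  have [f fc fD] := collapse_separation nDw.
  have ch : continuous (fun t : adjunction => adjoin t f).
    move=> t; apply: (@continuous_comp adjunction (stone_cech_cube R X) I adjoin
      (fun h : stone_cech_cube R X => h f) t); first exact: adjoin_continuous.
    exact: (@proj_continuous _ (fun=> I) f).
  have := congr1 (coordinate (mkcts ch)) xw.
  rewrite coordinate_emb coordinate_map.
  rewrite (_ : (mkcts ch : continuousType _ _) \o _ = f :> continuousType X I).
    by rewrite -[X in X = _]/(collapse d0 f) collapse_const// => /esym; exact: fD.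
  apply/continuousEP => x; rewrite -[LHS]/(collapse (emb x) f).
  by rewrite collapse_const// coordinate_emb.
move=> Cw; exists None => //; apply: stone_cech_eq => h.
rewrite coordinate_emb coordinate_map.
apply: contrapT => /eqP nh; have := @unit_interval_hausdorff R.
rewrite open_hausdorff => /(_ _ _ nh)[[A B] /= []].
rewrite !inE => hA wB [oA oB AB].
have [V oV VE] : open (h @^-1` A : set adjunction).
  by apply: open_comp => // t _; exact: cts_fun.
have Vd : V (collapse d0).
  by have : (adjoin @^-1` V) None by rewrite VE.
pose N := collapse @^-1` V `&`
  coordinate (h \o ext_embedding_map collapse_extension) @^-1` B.
have N0 : N !=set0.
  exists (set_val w); split=> //; rewrite /preimage /=.
  by rewrite (@collapse_D _ d0)//; exists w.
have oN : open N.
  apply: openI; apply: open_comp => // z _.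
    exact: collapse_continuous.
  exact: coordinate_continuous.
have [_ [/[swap] -[x _ <-] [Vx Bx]]] := stone_cech_emb_dense N0 oN.
have Ax : A (h (Some x)) by have : (adjoin @^-1` V) (Some x) by []; rewrite VE.
have : (A `&` B) (h (Some x)).
  by split=> //; move: Bx; rewrite /preimage /= coordinate_emb.
by rewrite AB.
Qed.

End collapse.

(** * The posets of extensions *)

Definition class_rep (c : one_point_extensions X) : one_point_extension X :=
  sval (cid (svalP c)).

Definition class_trace (c : one_point_extensions X) : nonempty_closed remainder :=
  closed_ext_trace R (class_rep c).

Lemma class_traceE (c : one_point_extensions X) T :
  sval c T -> sval (class_trace c) = ext_trace T.
Proof.
rewrite /class_trace /class_rep; case: (cid _) => T0 /= ->.
by rewrite (@ext_equivP R).
Qed.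

Lemma class_rep_in (c : one_point_extensions X) : sval c (class_rep c).
Proof.
rewrite /class_rep; case: (cid _) => T0 /= ->.
exact/(@ext_equivP R).
Qed.

Lemma class_trace_le (c1 c2 : one_point_extensions X) :
  extensions_le c2 c1 <-> sval (class_trace c1) `<=` sval (class_trace c2).
Proof.
split=> [[T2 [T1 [c2T2 c1T1 /(@ext_leP R)]]]|c12].
  by rewrite (class_traceE c2T2) (class_traceE c1T1).
exists (class_rep c2), (class_rep c1); split; try exact: class_rep_in.
exact/(@ext_leP R).
Qed.

Lemma class_trace_bij : bijective class_trace.
Proof.
apply: inj_surj_bijective => [[P1 [T1 E1]] [P2 [T2 E2]] c12|C].
  apply: eq_exist => /=.
  have T12 : ext_trace T1 = @ext_trace R X T2.
    rewrite -(@class_traceE (exist _ P1 (ex_intro _ T1 E1)) T1); last first.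
      by rewrite /= E1; exact/(@ext_equivP R).
    rewrite c12 (@class_traceE _ T2)//=.
    by rewrite E2; exact/(@ext_equivP R).
  rewrite E1 E2; apply/funext => T; apply/propext.
  by rewrite !(@ext_equivP R) T12.
pose T := collapse_extension C.
exists (exist _ (ext_equiv T) (ex_intro _ T erefl)).
apply: eq_sig_hprop => [A|]; first exact: Prop_irrelevance.
rewrite (@class_traceE _ T)/=; first exact: ext_trace_collapse.
exact/(@ext_equivP R).
Qed.

Lemma cech_complete_class_trace (c : one_point_extensions X) :
  (exists2 T, sval c T & cech_complete R T) <-> Gdelta (sval (class_trace c)).
Proof.
split=> [[T cT]|Gc]; first by rewrite (class_traceE cT) -cech_complete_ext_trace.
exists (class_rep c); first exact: class_rep_in.
exact/cech_complete_ext_trace.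
Qed.

Lemma extensions_trace_isomorphic :
  order_isomorphic (@extensions_le X)
    (fun A B : nonempty_closed remainder => sval B `<=` sval A).
Proof.
by exists class_trace; [exact: class_trace_bij|move=> c2 c1; exact: class_trace_le].
Qed.

Lemma cech_complete_extensions_trace_isomorphic :
  order_isomorphic (@cech_complete_extensions_le X R)
    (fun A B : {A : nonempty_closed remainder | Gdelta (sval A)} =>
      sval (sval B) `<=` sval (sval A)).
Proof.
apply: (order_isomorphic_sub (leQ := fun A B => sval B `<=` sval A)
  class_trace_bij); last exact: cech_complete_class_trace.
by move=> c2 c1; exact: class_trace_le.
Qed.

End realization.

(** * The main theorem *)

Theorem theorem2p5 (R : realType) (X Y : topologicalType)
    (X_hausdorff : hausdorff_space X)
    (X_locally_compact : locally_compact [set: X]%classic)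
    (Y_hausdorff : hausdorff_space Y)
    (Y_locally_compact : locally_compact [set: Y]%classic) :
  [<-> order_isomorphic (@extensions_le X) (@extensions_le Y);
       order_isomorphic (@cech_complete_extensions_le X R)
                        (@cech_complete_extensions_le Y R);
       homeomorphic (stone_cech_remainder R X) (stone_cech_remainder R Y)].
Proof.
have tX := locally_compact_tychonoff R X_hausdorff X_locally_compact.
have tY := locally_compact_tychonoff R Y_hausdorff Y_locally_compact.
have clX := @locally_compact_remainder_closed R X X_hausdorff X_locally_compact.
have clY := @locally_compact_remainder_closed R Y Y_hausdorff Y_locally_compact.
have isoX := extensions_trace_isomorphic tX clX.
have isoY := extensions_trace_isomorphic tY clY.
have isoCX := cech_complete_extensions_trace_isomorphic tX clX.
have isoCY := cech_complete_extensions_trace_isomorphic tY clY.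
have cptX := remainder_compact clX; have cptY := remainder_compact clY.
have hX := @remainder_hausdorff R X; have hY := @remainder_hausdorff R Y.
have homeo_ext :
    homeomorphic (stone_cech_remainder R X) (stone_cech_remainder R Y) ->
    order_isomorphic (@extensions_le X) (@extensions_le Y).
  move=> /homeomorphic_nonempty_closed[f fbij [fle _]].
  apply: order_isomorphic_trans isoX _.
  apply: order_isomorphic_trans (order_isomorphic_sym isoY).
  by exists f.
have homeo_cech :
    homeomorphic (stone_cech_remainder R X) (stone_cech_remainder R Y) ->
    order_isomorphic (@cech_complete_extensions_le X R)
                     (@cech_complete_extensions_le Y R).
  move=> /homeomorphic_nonempty_closed[f fbij [fle fG]].
  apply: order_isomorphic_trans isoCX _.
  apply: order_isomorphic_trans (order_isomorphic_sym isoCY).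
  exact: (order_isomorphic_sub (leP := fun A B => sval B `<=` sval A)
    (leQ := fun A B => sval B `<=` sval A) fbij fle fG).
tfae => [iso|iso|//].
- apply: homeo_cech.
  apply: (separating_order_isomorphic cptX hX cptY hY
    (separating_nonempty_closed hX) (separating_nonempty_closed hY)).
  apply: order_isomorphic_trans (order_isomorphic_sym isoX) _.
  exact: order_isomorphic_trans iso isoY.
- apply: (separating_order_isomorphic cptX hX cptY hY
    (separating_nonempty_closed_Gdelta R cptX hX)
    (separating_nonempty_closed_Gdelta R cptY hY)).
  apply: order_isomorphic_trans (order_isomorphic_sym isoCX) _.
  exact: order_isomorphic_trans iso isoCY.
Qed.
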